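(* Let $G$ be a countable left-orderable group that admits no nontrivial finite quotient and is not bi-orderable. Then $E_{\mathsf{lo}}(G)$ is not smooth.
   Context: A group $G$ is left-orderable if it admits a strict total ordering $<$ such that $g<h$ implies $fg<fh$ for all $f,g,h\in G$; it is bi-orderable if it admits a strict total ordering invariant under both left and right multiplication. A positive cone of $G$ is a subset $P\subseteq G$ with $P\cdot P\subseteq P$ and $P\sqcup P^{-1}=G\setminus\{1\}$. $\mathrm{LO}(G)$ is the set of positive cones of $G$, a closed subspace of $\{0,1\}^G$ with the product topology; $G$ acts on it by $g\cdot P=gPg^{-1}$. For $G$ countable, $E_{\mathsf{lo}}(G)$ is the orbit equivalence relation on $\mathrm{LO}(G)$ of this action. An equivalence relation $E$ on a standard Borel space $X$ is smooth if there are a standard Borel space $Y$ and a Borel map $f\colon X\to Y$ with $x\mathbin{E}y\iff f(x)=f(y)$ for all $x,y\in X$. *)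

(* Defs.v *)
From HB Require Import structures.
From mathcomp Require Import all_boot all_order all_algebra all_fingroup.
From mathcomp Require Import all_classical all_reals all_analysis.

Set Implicit Arguments.
Unset Strict Implicit.
Unset Printing Implicit Defensive.

Local Open Scope classical_set_scope.
Local Open Scope group_scope.

(* The carrier [G : groupType] is MathComp's abstract (possibly infinite)
   group; its notations live in [group_scope]. *)

Definition strict_total_order (T : Type) (lt : T -> T -> Prop) : Prop :=
  [/\ forall x, ~ lt x x,
      forall x y z, lt x y -> lt y z -> lt x z &
      forall x y, x <> y -> lt x y \/ lt y x].

Definition left_invariant (G : groupType) (lt : G -> G -> Prop) : Prop :=
  forall f g h : G, lt g h -> lt (f * g) (f * h).

Definition right_invariant (G : groupType) (lt : G -> G -> Prop) : Prop :=
  forall f g h : G, lt g h -> lt (g * f) (h * f).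

Definition left_orderable (G : groupType) : Prop :=
  exists lt : G -> G -> Prop, strict_total_order lt /\ left_invariant lt.

Definition bi_orderable (G : groupType) : Prop :=
  exists lt : G -> G -> Prop,
    [/\ strict_total_order lt, left_invariant lt & right_invariant lt].

(* Quotients of [G] are given, up to isomorphism, as images of surjective
   homomorphisms. *)
Definition no_nontrivial_finite_quotient (G : groupType) : Prop :=
  forall (H : finGroupType) (f : {multiplicative G -> H}),
    range f = [set: H] -> #|H| = 1%N.

Definition positive_cone (G : groupType) (P : set G) : Prop :=
  [/\ forall x y, P x -> P y -> P (x * y),
      P `|` [set x^-1 | x in P] = ~` [set 1] &
      P `&` [set x^-1 | x in P] = set0].

Definition LO_set (G : groupType) : set (prod_topology (fun _ : G => bool)) :=
  [set chi | positive_cone [set x | chi x]].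
Arguments LO_set : clear implicits.

(* The library equips [set_type A] with the subspace topology. *)
Definition LO (G : groupType) : topologicalType := set_type (LO_set G).

Definition cone (G : groupType) (P : LO G) : set G := [set x | (val P : G -> bool) x].

Definition conj_set (G : groupType) (g : G) (P : set G) : set G :=
  [set g * x * g^-1 | x in P].

Definition E_lo (G : groupType) (P Q : LO G) : Prop :=
  exists g : G, cone Q = conj_set g (cone P).

(* Measurable spaces are pairs of a type and a sigma-algebra, rather than
   [measurableType]s, since the latter carry a point and [LO G] may be empty. *)

Definition borel_sets (T : topologicalType) : set (set T) := <<s @open T >>.

(* Completeness is the axiom of the library's [completeType], which itself is
   restricted to pointed types. *)
Definition polish_metric (R : realType) (T : metricType R) : Prop :=
  (forall F : set_system T, ProperFilter F -> cauchy F -> exists x : T, F --> x) /\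
  (exists2 D : set T, countable D & dense D).

Definition standard_borel (R : realType) (Y : Type) (S : set (set Y)) : Prop :=
  exists (T : metricType R) (h : Y -> T),
    [/\ polish_metric T, bijective h &
        S = [set h @^-1` B | B in @borel_sets T]].

Definition smooth (R : realType) (X : Type) (S : set (set X))
    (E : X -> X -> Prop) : Prop :=
  exists (Y : Type) (SY : set (set Y)) (f : X -> Y),
    [/\ standard_borel R SY,
        forall B, SY B -> S (f @^-1` B) &
        forall x y, E x y <-> f x = f y].

(* Main.v *)
Require Import Defs.
From HB Require Import structures.
From mathcomp Require Import all_boot all_order all_algebra all_fingroup.
From mathcomp Require Import all_classical all_reals all_analysis.

Set Implicit Arguments.
Unset Strict Implicit.
Unset Printing Implicit Defensive.

Import Order.TTheory GRing.Theory Num.Theory.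

Local Open Scope classical_set_scope.
Local Open Scope group_scope.

(** The group [G] acts by conjugation, continuously, on the compact space of its
    positive cones.  A cone with a finite orbit would be fixed by [G], because a
    group without nontrivial finite quotients has no nontrivial action on a finite
    set ([finite_orbit_fixed]); but a fixed cone is the cone of a bi-invariant
    order ([fixed_cone_bi_orderable]).  Hence all orbits are infinite, and it is
    enough to show that a countable group acting continuously on a nonempty
    compact Hausdorff space with infinite orbits only never has a smooth orbit
    equivalence relation ([infinite_orbits_not_smooth]).

    By Zorn's lemma there is a minimal nonempty closed invariant set [M]
    ([exists_minimal]), in which every orbit is dense.  If [M] had an isolated
    point, compactness would make [M] finite, so [M] is perfect
    ([minimal_perfect]) and each orbit, being countable, is meager in [M].  Every
    Borel set has the Baire property in [M] ([borel_baire_property]), and density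
    of the orbits forces an invariant one to be meager or comeager in [M]
    ([invariant_zero_one]).  Suppose that the orbits are the fibres of a Borel map
    [f] to a standard Borel space.  A countable family of Borel sets separates the
    points of the target ([standard_borel_separating]); the preimages of its
    members are invariant, and discarding for each of them the meager alternative
    leaves a comeager subset of [M] on which [f] is constant, that is, a comeager
    set inside one orbit.  Then [M] is meager in itself, contradicting the Baire
    category theorem for compact Hausdorff spaces ([compact_not_meager]). *)

(** * Baire category relative to a subset *)

(** These notions refer to the subspace [M] but are phrased with open and closed
    subsets of the ambient space, so that Borel sets and homeomorphisms of [X] can
    be used without being transported to a subtype. *)
Definition nowhere_dense_in (X : topologicalType) (M F : set X) : Prop :=
  closed F /\ forall U, open U -> U `&` M `<=` F -> U `&` M = set0.

Definition meager_in (X : topologicalType) (M A : set X) : Prop :=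
  exists F : nat -> set X,
    (forall n, nowhere_dense_in M (F n)) /\ A `&` M `<=` \bigcup_n F n.

Lemma meager_in_sub (X : topologicalType) (M A B : set X) :
  A `&` M `<=` B -> meager_in M B -> meager_in M A.
Proof.
move=> AB [F [Fnd BF]]; exists F; split=> // x [Ax Mx].
by apply: BF; split=> //; exact: AB.
Qed.

Lemma nowhere_dense_meager (X : topologicalType) (M F : set X) :
  nowhere_dense_in M F -> meager_in M F.
Proof. by move=> Fnd; exists (fun=> F); split=> // x [Fx _]; exists 0%N. Qed.

Lemma meager_in_bigcup (X : topologicalType) (M : set X) (A : nat -> set X) :
  (forall n, meager_in M (A n)) -> meager_in M (\bigcup_n A n).
Proof.
move=> /choice[F AF].
pose H k := let: (i, j) := odflt (0%N, 0%N) (unpickle k) in F i j.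
exists H; split=> [k|x [[i _ Aix] Mx]].
  by rewrite /H; case: (odflt _ _) => i j; exact: (AF i).1.
have [j _ Fijx] := (AF i).2 x (conj Aix Mx).
by exists (pickle (i, j)) => //; rewrite /H pickleK.
Qed.

Lemma meager_inU (X : topologicalType) (M A B : set X) :
  meager_in M A -> meager_in M B -> meager_in M (A `|` B).
Proof.
move=> mA mB.
apply: (@meager_in_sub _ _ _ (\bigcup_n (if n is 0%N then A else B))).
  by move=> x [[Ax|Bx] _]; [exists 0%N|exists 1%N].
by apply: meager_in_bigcup; case.
Qed.

Definition baire_property_in (X : topologicalType) (M A : set X) : Prop :=
  exists2 U, open U & meager_in M ((A `\` U) `|` (U `\` A)).

Lemma meager_in0 (X : topologicalType) (M : set X) : meager_in M set0.
Proof.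
apply: nowhere_dense_meager; split; first exact: closed0.
by move=> U _; rewrite subset0.
Qed.

Lemma open_baire_property (X : topologicalType) (M U : set X) :
  open U -> baire_property_in M U.
Proof.
by move=> oU; exists U => //; rewrite setDv setU0; exact: meager_in0.
Qed.

(** Sets with the Baire property form a sigma-algebra.  If [A] is [U] up to a
    meager set, its complement is the exterior of [U] in [M] up to a meager set,
    since the boundary of [U] in [M] is nowhere dense. *)
Lemma borel_baire_property (X : topologicalType) (M B : set X) :
  borel_sets B -> baire_property_in M B.
Proof.
apply: smallest_sub; last by move=> U; exact: open_baire_property.
split; first by apply: open_baire_property; exact: open0.
- move=> A [U oU mAU]; exists (~` closure (U `&` M)).
    by rewrite openC; exact: closed_closure.
  apply: (@meager_in_sub _ _ _ ((A `\` U `|` U `\` A) `|`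
                               (closure (U `&` M) `\` U))).
    move=> x [[[[_ nAx] /contrapT cx]|[ncx nTAx]] Mx].
      by have [Ux|nUx] := pselect (U x); [left; right|right].
    have Ax : A x by apply: contrapT => nAx; exact: nTAx.
    left; left; split=> // Ux; apply: ncx; exact: subset_closure.
  apply: meager_inU => //; apply: nowhere_dense_meager; split.
    by rewrite setDE; apply: closedI; [exact: closed_closure|exact: open_closedC].
  move=> V oV VM; apply/seteqP; split=> // x VMx.
  have [cx _] := VM x VMx.
  have [y [[Uy My] Vy]] := cx V (open_nbhs_nbhs (conj oV VMx.1)).
  by have [_] := VM y (conj Vy My).
- move=> A bA.
  have /choice[U UP] n : exists V, open V /\
      meager_in M ((A n `\` V) `|` (V `\` A n)).
    by have [V ? ?] := bA n; exists V.
  exists (\bigcup_n U n); first by apply: bigcup_open => n _; exact: (UP n).1.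
  apply: meager_in_sub (meager_in_bigcup (fun n => (UP n).2)).
  move=> x [[[[n _ Ax] nUx]|[[n _ Ux] nAx]] Mx]; exists n => //.
    by left; split=> // ?; apply: nUx; exists n.
  by right; split=> // ?; apply: nAx; exists n.
Qed.

(** The proof is the shrinking construction of open sets [V n] meeting [M],
    the closure of [V n.+1] avoiding [F n]; compactness replaces completeness. *)
Theorem compact_not_meager (X : topologicalType) (M : set X) :
  hausdorff_space X -> compact [set: X] -> closed M -> M !=set0 ->
  ~ meager_in M M.
Proof.
move=> hX cX cM [x0 Mx0] [F [Fnd MF]].
pose good (V : set X) := open V /\ V `&` M !=set0.
have shrink (nV : nat * set X) : exists W, good nV.2 ->
    good W /\ closure W `<=` nV.2 `\` F nV.1.
  case: nV => n V /=; have [[oV [x VMx]]|nV] := pselect (good V); last by exists V => /nV.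
  have [p [[Vp Mp] nFp]] : exists p, (V `&` M) p /\ ~ F n p.
    apply: contrapT => no; suff VM0 : V `&` M = set0 by rewrite VM0 in VMx.
    by apply: (Fnd n).2 => // y VMy; apply: contrapT => nFy; apply: no; exists y.
  have /(compact_regular hX cX filterT) : nbhs p (V `&` ~` F n).
    apply: open_nbhs_nbhs; split=> //; apply: openI => //.
    by rewrite openC; exact: (Fnd n).1.
  move=> [W Wp cW]; exists (interior W) => _; split.
    split; first exact: open_interior.
    by exists p; split=> //; exact: nbhs_singleton (nbhs_interior Wp).
  move=> y cy; apply: cW; exact: (closureS (@interior_subset _ W)) cy.
have [next nextP] := choice shrink.
pose V := fix V n := if n is m.+1 then next (m, V m) else setT.
have goodV n : good (V n).
  elim: n => [|n IH] /=; last exact: (nextP (n, V n) IH).1.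
  by split; [exact: openT|exists x0].
have stepV n : closure (V n.+1) `<=` V n `\` F n.
  exact: (nextP (n, V n) (goodV n)).2.
have subV n k : V (n + k)%N `<=` V n.
  elim: k => [|k IH]; first by rewrite addn0.
  by rewrite addnS => x /subset_closure /stepV [/IH].
have [p pP] := choice (fun n => (goodV n).2).
have cptM : compact M by apply: subclosed_compact cM cX _.
have [|q [Mq clq]] := cptM (p @ \oo) _.
  by exists 0%N => // n _; exact: (pP n).2.
have [n _ Fq] := MF q (conj Mq Mq).
have cVq : closure (V n.+1) q.
  move=> B nB; apply: clq => //; exists n.+1 => // k /= nk.
  by apply: (subV n.+1 (k - n.+1)%N); rewrite subnKC //; exact: (pP k).1.
by have [] := stepV n q cVq.
Qed.

(** * Minimal sets of a continuous action *)

Definition is_group_action (G : groupType) (X : Type) (act : G -> X -> X) : Prop :=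
  (forall x, act 1 x = x) /\ (forall g h x, act (g * h) x = act g (act h x)).

Definition act_invariant (G X : Type) (act : G -> X -> X) (A : set X) : Prop :=
  forall g x, A x -> A (act g x).

(** Minimality is stated in the form in which it is used: from every point of
    [M] the orbit enters every open set that meets [M]. *)
Definition minimal_set (G : Type) (X : topologicalType) (act : G -> X -> X)
    (M : set X) : Prop :=
  [/\ closed M, M !=set0, act_invariant act M &
      forall U, open U -> U `&` M !=set0 ->
        forall x, M x -> exists g, U (act g x)].

Lemma act_cancel (G : groupType) (X : Type) (act : G -> X -> X) (g : G) :
  is_group_action act -> cancel (act g) (act g^-1).
Proof. by move=> [act1 actM] x; rewrite -actM mulVg. Qed.

Lemma act_Vcancel (G : groupType) (X : Type) (act : G -> X -> X) (g : G) :
  is_group_action act -> cancel (act g^-1) (act g).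
Proof. by move=> [act1 actM] x; rewrite -actM mulgV. Qed.

Lemma countable_enumeration (G : groupType) :
  countable [set: G] -> exists e : nat -> G, forall g, exists n, e n = g.
Proof.
move=> /countable_injP[c cI].
have /choice[e eP] n : exists g, forall h, c h = n -> g = h.
  have [[g gn]|no] := pselect (exists g, c g = n).
    by exists g => h hn; apply: cI; rewrite ?inE// gn hn.
  by exists 1 => h hn; case: no; exists h.
by exists e => g; exists (c g); exact: eP.
Qed.

(** A maximal proper invariant open set [U] has minimal complement: an open set
    missed by some orbit in the complement could be saturated and added to [U].
    By compactness, the union of a chain of proper open sets stays proper. *)
Lemma exists_minimal (G : groupType) (X : topologicalType) (act : G -> X -> X) :
  is_group_action act -> (forall g, continuous (act g)) ->
  compact [set: X] -> [set: X] !=set0 -> exists M, minimal_set act M.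
Proof.
move=> actP cact cX [x0 _].
pose P (U : set X) := [/\ open U, act_invariant act U & ~ ([set: X] `<=` U)].
have [C CP Ctot|U [[oU iU nU] Umax]] := @Zorn_bigcup X P.
  split.
  - by apply: bigcup_open => V /CP[].
  - by move=> g x [V CV Vx]; exists V => //; have [_ iV _] := CP V CV; exact: iV.
  move=> cov; have [V0 CV0 _] := cov x0 I.
  pose F : set_system (set X) :=
    filter_from C (fun V => [set W | C W /\ V `<=` W]).
  have FF : Filter F.
    apply: filter_from_filter; first by exists V0.
    move=> V W CV CW; have [VW|WV] := Ctot V W CV CW.
      exists W => // T [CT WT]; split; split=> //; exact: subset_trans WT.
    exists V => // T [CT VT]; split; split=> //; exact: subset_trans VT.
  move/compact_near_coveringP : cX => /(_ _ F (fun V x => V x) FF) [|V CV /(_ V)].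
    move=> x _; have [V CV Vx] := cov x I.
    exists (V, [set W | C W /\ V `<=` W]); last by move=> [y W] [/= Vy [_]]; apply.
    split=> /=; last by exists V.
    by apply: open_nbhs_nbhs; split=> //; have [] := CP V CV.
  by have [_ _ nV] := CP V CV => /(_ (conj CV (@subset_refl _ V))) /nV.
exists (~` U); split.
- exact: open_closedC.
- by apply: contrapT => no; apply: nU => x _; apply: contrapT => nUx; apply: no; exists x.
- by move=> g x nUx Ugx; apply: nUx; rewrite -(act_cancel g actP x); exact: iU.
move=> V oV [y [Vy nUy]] x nUx; apply: contrapT => no.
pose W := U `|` \bigcup_g (act g @^-1` V).
apply: (Umax W).
  split; first by move=> z Uz; left.
  move=> /(_ y) h; apply: nUy; apply: h; right; exists 1 => //=.
  by rewrite actP.1.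
split.
- apply: openU => //; apply: bigcup_open => g _.
  by apply: open_comp => // z _; exact: cact.
- move=> g z [Uz|[h _ /= Vhz]]; first by left; exact: iU.
  by right; exists (h * g^-1) => //=; rewrite actP.2 act_cancel.
by move=> /(_ x I) [//|[g _ Vgx]]; apply: no; exists g.
Qed.

(** If [p] were isolated in [M], finitely many translates of its isolating
    neighbourhood would cover [M] by compactness, and each meets [M] in a single
    point of the orbit of [p]. *)
Lemma minimal_perfect (G : groupType) (X : topologicalType)
    (act : G -> X -> X) (M : set X) (p : X) :
  hausdorff_space X -> compact [set: X] -> countable [set: G] ->
  is_group_action act -> (forall g, continuous (act g)) ->
  minimal_set act M -> M p -> infinite_set (range (act^~ p)) ->
  nowhere_dense_in M [set p].
Proof.
move=> hX cX /countable_enumeration[e eG] actP cact [cM _ iM Mmin] Mp infp.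
split; first exact/accessible_closed_set1/hausdorff_accessible.
move=> U oU UMp; apply: contrapT => /eqP/set0P UM0.
have cptM : compact M by apply: subclosed_compact cM cX _.
pose Q n x := exists2 i, (i < n)%N & U (act (e i) x).
move/compact_near_coveringP : cptM => /(_ nat \oo Q _) [].
  move=> x Mx; have [g Ugx] := Mmin U oU UM0 x Mx.
  have [i eig] := eG g.
  exists (act g @^-1` U, [set n | (i < n)%N]).
    split; last by exists i.+1.
    by apply: open_nbhs_nbhs; split=> //; apply: open_comp => // z _; exact: cact.
  by move=> [y n] [/= Uy ilt]; exists i; rewrite ?eig.
move=> n _ /(_ n (leqnn n)) MQ; apply: infp.
apply: (@sub_finite_set _ _ [set act (e i)^-1 p | i in `I_n]); last first.
  exact/finite_image/finite_II.
move=> _ [g _ <-]; have [i ilt Ui] := MQ _ (iM g p Mp).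
have /= pE := UMp _ (conj Ui (iM (e i) _ (iM g p Mp))).
by exists i => //=; rewrite -{1}pE act_cancel.
Qed.

Lemma nowhere_dense_in_preimage (G : groupType) (X : topologicalType)
    (act : G -> X -> X) (M F : set X) (g : G) :
  is_group_action act -> (forall g, continuous (act g)) -> act_invariant act M ->
  nowhere_dense_in M F -> nowhere_dense_in M (act g @^-1` F).
Proof.
move=> actP cact iM [cF Fnd]; split.
  by apply: preimage_closed => // z _; exact: cact.
move=> U oU UMF; apply/seteqP; split=> // x [Ux Mx].
suff V0 : (act g^-1 @^-1` U) `&` M = set0.
  have : ((act g^-1 @^-1` U) `&` M) (act g x).
    by split; [rewrite /= act_cancel|exact: iM].
  by rewrite V0.
apply: Fnd; first by apply: open_comp => // z _; exact: cact.
by move=> y [/= Uy My]; rewrite -(act_Vcancel g actP y); apply: UMF; split=> //; exact: iM.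
Qed.

Lemma meager_in_preimage (G : groupType) (X : topologicalType)
    (act : G -> X -> X) (M A : set X) (g : G) :
  is_group_action act -> (forall g, continuous (act g)) -> act_invariant act M ->
  meager_in M A -> meager_in M (act g @^-1` A).
Proof.
move=> actP cact iM [F [Fnd AF]]; exists (fun n => act g @^-1` F n); split.
  by move=> n; exact: nowhere_dense_in_preimage.
by move=> x [/= Ax Mx]; have [n _ Fx] := AF _ (conj Ax (iM g x Mx)); exists n.
Qed.

(** If [A] agrees up to a meager set with an open [U] meeting [M], the
    translates of [U] cover [M] by minimality and [A] is comeager in each. *)
Lemma invariant_zero_one (G : groupType) (X : topologicalType)
    (act : G -> X -> X) (M A : set X) :
  countable [set: G] -> is_group_action act -> (forall g, continuous (act g)) ->
  minimal_set act M -> act_invariant act A -> baire_property_in M A ->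
  meager_in M A \/ meager_in M (~` A).
Proof.
move=> /countable_enumeration[e eG] actP cact [cM _ iM Mmin] iA [U oU mAU].
have [UM|/eqP/set0P UM] := pselect (U `&` M = set0); [left|right].
  apply: meager_in_sub mAU => x [Ax Mx]; left; split=> // Ux.
  by have : (U `&` M) x by []; rewrite UM.
apply: meager_in_sub
  (meager_in_bigcup (fun n => meager_in_preimage (e n) actP cact iM mAU)).
move=> x [nAx Mx]; have [g Ugx] := Mmin U oU UM x Mx.
have [n eng] := eG g; exists n => //=; rewrite eng; right; split=> // Agx.
by apply: nAx; rewrite -(act_cancel g actP x); exact: iA.
Qed.

(** * Non-smoothness of actions without finite orbits *)

(** The separating sets are the balls of radius [1 / k.+1] around the points of a
    countable dense set. *)
Lemma standard_borel_separating (R : realType) (Y : Type) (S : set (set Y)) :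
  standard_borel R S -> exists B : nat -> set Y,
    (forall n, S (B n)) /\
    (forall y z, (forall n, B n y -> B n z) -> y = z).
Proof.
move=> [T [h [[_ [D /countable_injP[c cI] dD]] hbij ->]]].
pose r (k : nat) : R := (k.+1%:R^-1)%R.
(* [c] is injective on [D], so each union below has at most one term. *)
pose O n : set T := let: (i, k) := odflt (0%N, 0%N) (unpickle n) in
  \bigcup_(d in [set d | D d /\ c d = i]) interior (ball d (r k)).
exists (fun n => h @^-1` O n); split=> [n|y z yz].
  exists (O n) => //; apply: sub_sigma_algebra; rewrite /O.
  case: (odflt _ _) => i k.
  by apply: bigcup_open => d _; exact: open_interior.
apply: (bij_inj hbij); apply: (@metric_hausdorff R T) => U V /= yU zV.
suff bz k : ball (h y) (r k) (h z).
  have [e /= e0 eU] : nbhs_ball (h y) U by rewrite nbhs_ballE.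
  have [k _ /(_ k (leqnn k)) rk] := near_infty_natSinv_lt (PosNum e0).
  exists (h z); split; last exact: nbhs_singleton.
  by apply: eU; apply: le_ball (bz k); exact: ltW.
have rp : (0 < r (k.*2.+1))%R by rewrite invr_gt0 ltr0n.
have rE : (r k = r k.*2.+1 + r k.*2.+1)%R.
  rewrite /r -doubleS -muln2 natrM invfM -splitr.
  by [].
have [d [dy Dd]] : interior (ball (h y) (r k.*2.+1 / 2)) `&` D !=set0.
  apply: dD; last exact: open_interior.
  exists (h y); apply: nbhs_singleton; apply: nbhs_interior.
  by apply: nbhsx_ballx; rewrite divr_gt0.
have := yz (pickle (c d, k.*2.+1)); rewrite /O /= pickleK /=.
case.
  exists d => //; rewrite /interior /=.
  have : nbhs (h y) (ball (h y) (r k.*2.+1 / 2)).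
    by apply: nbhsx_ballx; rewrite divr_gt0.
  apply: filterS => w yw; rewrite [r _]splitr.
  apply: ball_triangle yw; apply: ball_sym; exact: interior_subset dy.
move=> d' [Dd' cd']; have -> : d' = d by apply: cI; rewrite ?inE.
move=> /interior_subset dz; rewrite rE; apply: ball_triangle dz.
have := interior_subset dy; apply: le_ball.
by rewrite ler_pdivrMr // mulr_natr mulr2n lerDl ltW.
Qed.

(** On a minimal set [M] an invariant Borel map to a separated space is
    constant off a meager set, by the zero-one law applied to countably many
    separating sets; a complete invariant thus makes all of [M] but a meager set
    a single orbit.  Orbits being countable and [M] perfect, [M] is meager in
    itself, against the Baire category theorem. *)
Theorem infinite_orbits_not_smooth (R : realType) (G : groupType)
    (X : topologicalType) (act : G -> X -> X) :
  hausdorff_space X -> compact [set: X] -> [set: X] !=set0 ->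
  countable [set: G] -> is_group_action act -> (forall g, continuous (act g)) ->
  (forall x, infinite_set (range (act^~ x))) ->
  ~ smooth R (@borel_sets X) (fun x y => exists g, y = act g x).
Proof.
move=> hX cX X0 cG actP cact inf.
move=> [Y [S [f [/standard_borel_separating[B [SB Bsep]] fS fE]]]].
have [M Mmin] := exists_minimal actP cact cX X0.
have [cM M0 iM _] := Mmin.
have fI g x : f (act g x) = f x by symmetry; apply/fE; exists g.
have /choice[Z ZP] n : exists Z, meager_in M Z /\
    (Z = f @^-1` B n \/ Z = ~` (f @^-1` B n)).
  have [||mA|mA] := @invariant_zero_one _ _ _ _ (f @^-1` B n) cG actP cact Mmin.
  - by move=> g x; rewrite /= fI.
  - by apply: borel_baire_property; exact: fS.
  - by exists (f @^-1` B n); split=> //; left.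
  - by exists (~` (f @^-1` B n)); split=> //; right.
have mZ := meager_in_bigcup (fun n => (ZP n).1).
have MnZ : exists2 x, M x & ~ (\bigcup_n Z n) x.
  apply: contrapT => no; apply: (compact_not_meager hX cX cM M0).
  apply: meager_in_sub mZ => x [_ Mx].
  by apply: contrapT => nZ; apply: no; exists x.
have [x Mx nZx] := MnZ.
have [e eG] := countable_enumeration cG.
have mO : meager_in M (\bigcup_n [set act (e n) x]).
  apply: meager_in_bigcup => n; apply: nowhere_dense_meager.
  exact: (minimal_perfect hX cX cG actP cact Mmin (iM _ _ Mx) (inf _)).
apply: (compact_not_meager hX cX cM M0).
apply: meager_in_sub (meager_inU mZ mO) => y [_ My].
have [Zy|nZy] := pselect ((\bigcup_n Z n) y); [by left|right].
have /fE[g ->] : f x = f y.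
  apply: Bsep => n Bx; apply: contrapT => nBy.
  by have [_ [ZE|ZE]] := ZP n; [apply: nZx|apply: nZy]; exists n; rewrite ?ZE.
by have [n <-] := eG g; exists n.
Qed.

(** * Finite orbits *)

(** The permutations of a finite orbit induced by [G] form a finite quotient,
    hence the trivial group. *)
Lemma finite_orbit_fixed (G : groupType) (X : choiceType) (act : G -> X -> X)
    (x : X) :
  no_nontrivial_finite_quotient G -> is_group_action act ->
  finite_set (range (act^~ x)) -> forall g, act g x = x.
Proof.
move=> noquo actP /finite_seqP[s /seteqP[orb_sub s_sub]].
have orb_s y : y \in s <-> exists g, act g x = y.
  by split=> [/s_sub[g _ <-]|[g <-]]; [exists g|apply: orb_sub; exists g].
have s_act g (u : seq_sub s) : act g^-1 (val u) \in s.
  have /orb_s[h <-] := valP u.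
  by apply/orb_s; exists (g^-1 * h); rewrite actP.2.
pose tau g (u : seq_sub s) : seq_sub s := SeqSub (s_act g u).
have tauI g : injective (tau g).
  by move=> u v /(congr1 val) /= /(can_inj (act_Vcancel g actP)) /val_inj.
pose rho g : {perm seq_sub s} := perm (@tauI g).
(* Permutations compose from left to right, whence the inverse in [tau]. *)
have rhoM g h : rho (g * h) = (rho g * rho h).
  by apply/permP => u; rewrite permM !permE; apply: val_inj; rewrite /= invgM actP.2.
pose K : {set {perm seq_sub s}} := [set p | `[< exists g, rho g = p >]]%SET.
have rhoK g : rho g \in K by rewrite inE; apply/asboolP; exists g.
have Krho p : p \in K -> exists g, rho g = p by rewrite inE => /asboolP.
have rho1 : rho 1 = 1.
  by apply/permP => u; rewrite perm1 permE; apply: val_inj; rewrite /= invg1 actP.1.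
have gK : group_set K.
  apply/group_setP; split; first by rewrite -rho1.
  by move=> p q /Krho[g <-] /Krho[h <-]; rewrite -rhoM.
pose KG := group gK.
pose psi g : subg_of KG := subg KG (rho g).
have psiM : {morph psi : g h / g * h}.
  by move=> g h; rewrite /psi rhoM subgM.
pose f : {multiplicative G -> subg_of KG} :=
  HB.pack psi (isMultiplicative.Build G (subg_of KG) psi psiM).
have /noquo card1 : range f = [set: subg_of KG].
  apply/seteqP; split=> // u _.
  have /Krho[g gu] : val u \in K by exact: valP.
  exists g => //.
  by apply: val_inj; rewrite /= /psi subgK.
move=> g.
have xs : x \in s by apply/orb_s; exists 1; exact: actP.1.
have psi1 : psi g^-1 = psi 1.
  apply/eqP; move: card1 => /eqP; rewrite -cardsT => /cards1P[a aE].
  have inA (u : subg_of KG) : u = a by apply/set1P; rewrite -aE inE.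
  by rewrite (inA (psi g^-1)) (inA (psi 1)).
have : rho g^-1 = rho 1.
  by move/(congr1 val): psi1; rewrite /psi /= !subgK.
move=> /permP /(_ (SeqSub xs)); rewrite rho1 perm1 permE => /(congr1 val).
by rewrite /= invgK.
Qed.

(** * The space of positive cones *)

Lemma set_type_compact (X : topologicalType) (A : set X) :
  compact A -> compact [set: set_type A].
Proof.
move=> cA F FF _.
have [|p [Ap clp]] := cA ((val : set_type A -> X) @ F) _.
  by apply: (@filterS _ F _ setT _ _ filterT) => u _; exact: (set_valP u).
exists (SigSub (mem_set Ap)); split=> // B C FB.
rewrite nbhsE => -[_ [[V oV <-] /= Vp] VC].
have [||_ [[u Bu <-] Vu]] := clp [set (val : set_type A -> X) u | u in B] V.
- by apply: (@filterS _ F _ B _ _ FB) => u Bu; exists u.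
- exact: open_nbhs_nbhs.
by exists u; split=> //; exact: VC.
Qed.

Lemma set_type_hausdorff (X : topologicalType) (A : set X) :
  hausdorff_space X -> hausdorff_space (set_type A).
Proof.
move=> hX p q pq; apply: val_inj; apply: hX => U V pU qV.
have vc : continuous (val : set_type A -> X) := @initial_continuous _ _ _.
have [u [Uu Vu]] := pq _ _ (vc p U pU) (vc q V qV).
by exists (val u).
Qed.

Lemma coordinate_continuous (I : eqType) (T : I -> topologicalType) (i : I) :
  continuous (fun f : prod_topology T => f i).
Proof. exact: proj_continuous. Qed.

Lemma positive_coneP (G : groupType) (P : set G) : positive_cone P <->
  [/\ forall x y, P x -> P y -> P (x * y), ~ P 1 &
      forall x, x <> 1 -> P x \/ P x^-1].
Proof.
split=> [[PM PT P0]|[PM P1 PT]]; split=> //.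
- move=> h; suff : (~` [set 1] : set G) 1 by apply.
  by rewrite -PT; left.
- move=> x x1; have : (~` [set 1] : set G) x by [].
  by rewrite -PT => -[|[y Py <-]]; [left|right; rewrite invgK].
- apply/seteqP; split=> x /=.
    move=> [Px|[y Py <-]] x1; apply: P1; first by rewrite -x1.
    by move: Py; rewrite -[y]invgK x1 invg1.
  by move=> /PT[|Px]; [left|right; exists x^-1 => //; rewrite invgK].
- apply/seteqP; split=> // x [Px [y Py yx]]; apply: P1.
  by rewrite -(mulgV y) yx; exact: PM.
Qed.

(** Each instance of the cone axioms involves finitely many coordinates, so they define
    a closed subset of the cube. *)
Lemma LO_set_closed (G : groupType) : closed (LO_set G).
Proof.
pose C (x : G) (b : bool) : set (prod_topology (fun _ : G => bool)) :=
  [set chi | chi x = b].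
have cC x b : closed (C x b).
  have /continuous_closedP /(_ [set b]) := @coordinate_continuous G (fun=> bool) x.
  apply; exact: discrete_closed.
have -> : LO_set G =
    (\bigcap_x \bigcap_y (C x false `|` C y false `|` C (x * y) true)) `&`
    (C 1 false `&` \bigcap_(x in [set x | x <> 1]) (C x true `|` C x^-1 true)).
  apply/seteqP; split=> chi.
    move=> /positive_coneP /= [PM P1 PT]; split.
      move=> x _ y _; rewrite /C /=.
      case cx: (chi x); last by left; left.
      case cy: (chi y); last by left; right.
      by right; exact: PM.
    split; first exact/negP.
    by move=> x /= /PT.
  move=> [PM [P1 PT]]; apply/positive_coneP; split=> /=.
  - move=> x y cx cy; have [[|]|//] := PM x I y I; rewrite /C /=.
      by rewrite cx.
    by rewrite cy.
  - by rewrite P1.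
  - exact: PT.
apply: closedI.
  by apply: closed_bigI => x _; apply: closed_bigI => y _;
    do 2 apply: closedU => //.
apply: closedI => //.
by apply: closed_bigI => x _; apply: closedU.
Qed.

Lemma LO_compact (G : groupType) : compact [set: LO G].
Proof.
apply: set_type_compact.
apply: (subclosed_compact (@LO_set_closed G) _ (@subsetT _ _)).
have := @tychonoff G (fun=> bool) (fun=> [set: bool]) (fun=> bool_compact).
by congr compact; apply/seteqP; split.
Qed.

Lemma LO_hausdorff (G : groupType) : hausdorff_space (LO G).
Proof.
apply: set_type_hausdorff.
by apply: hausdorff_product => _; exact: discrete_hausdorff.
Qed.

Definition conj_fun (G : groupType) (g : G)
    (chi : prod_topology (fun _ : G => bool)) :
    prod_topology (fun _ : G => bool) :=
  fun x => chi (g^-1 * x * g).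

Lemma conj_fun_LO (G : groupType) (g : G) chi :
  LO_set G chi -> LO_set G (conj_fun g chi).
Proof.
move=> /positive_coneP /= [PM P1 PT]; apply/positive_coneP.
rewrite /conj_fun; split=> /= [x y Px Py||x x1].
- have -> : g^-1 * (x * y) * g = (g^-1 * x * g) * (g^-1 * y * g).
    by rewrite !mulgA mulgK.
  exact: PM.
- by rewrite mulg1 mulVg.
- have -> : g^-1 * x^-1 * g = (g^-1 * x * g)^-1 by rewrite !invgM invgK mulgA.
  apply: PT => gx; apply: x1.
  by rewrite -[x](mulKg g^-1) invgK -(mulgK g (g^-1 * x)) gx mul1g mulgV.
Qed.

Definition LO_act (G : groupType) (g : G) (P : LO G) : LO G :=
  SigSub (mem_set (conj_fun_LO g (set_valP P))).

Lemma LO_act_group_action (G : groupType) : is_group_action (@LO_act G).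
Proof.
split=> [P|g h P]; apply: val_inj; apply/funext => x /=; rewrite /conj_fun.
  by rewrite invg1 mul1g mulg1.
by rewrite invgM !mulgA.
Qed.

Lemma LO_act_continuous (G : groupType) (g : G) : continuous (@LO_act G g).
Proof.
have conj_cont : continuous (@conj_fun G g).
  move=> chi; apply/cvg_sup => x A; rewrite nbhsE => -[_ [[U oU <-] /= Ux] UA].
  have := @coordinate_continuous G (fun=> bool) (g^-1 * x * g) chi.
  move=> /(_ U (open_nbhs_nbhs (conj oU Ux))) Uchi.
  by apply: (@filterS _ (nbhs chi) _ _ _ _ Uchi) => psi Upsi; exact: UA.
apply/continuousP => _ [U oU <-].
exists (@conj_fun G g @^-1` U) => //.
by move/continuousP : conj_cont; exact.
Qed.

Lemma cone_LO_act (G : groupType) (g : G) (P : LO G) :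
  cone (LO_act g P) = conj_set g (cone P).
Proof.
apply/seteqP; split=> x; rewrite /cone /= /conj_fun.
  move=> Px; exists (g^-1 * x * g) => //.
  by rewrite !mulgA mulgV mul1g mulgK.
by move=> [y Py <-]; rewrite !mulgA mulVg mul1g mulgVK.
Qed.

Lemma cone_inj (G : groupType) : injective (@cone G).
Proof.
move=> P Q PQ; apply: val_inj; apply/funext => x; apply/idP/idP => h.
  by have : cone P x by []; rewrite PQ.
by have : cone Q x by []; rewrite -PQ.
Qed.

Lemma E_loE (G : groupType) (P Q : LO G) :
  E_lo P Q <-> exists g, Q = LO_act g P.
Proof.
split=> -[g PQ]; exists g; last by rewrite PQ cone_LO_act.
by apply: cone_inj; rewrite PQ cone_LO_act.
Qed.

Lemma left_orderable_LO (G : groupType) :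
  left_orderable G -> [set: LO G] !=set0.
Proof.
move=> [lt [[irr tr tot] linv]].
pose chi : prod_topology (fun _ : G => bool) := fun x => `[< lt 1 x >].
have Lchi : LO_set G chi.
  apply/positive_coneP; split=> /=.
  - move=> x y /asboolP lx /asboolP ly; apply/asboolP; apply: tr lx _.
    by rewrite -{1}[x]mulg1; exact: linv.
  - by move/asboolP/irr.
  - move=> x x1; have [lx|/(linv x^-1)] := tot 1 x (nesym x1).
      by left; apply/asboolP.
    by rewrite mulVg mulg1 => lx; right; apply/asboolP.
by exists (SigSub (mem_set Lchi)).
Qed.

(** A cone [P] defines the left-invariant order [x < y] iff [P (x^-1 * y)];
    conjugation-invariance of [P] is its right-invariance. *)
Lemma fixed_cone_bi_orderable (G : groupType) (P : LO G) :
  (forall g, LO_act g P = P) -> bi_orderable G.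
Proof.
move=> fixP; have /positive_coneP[PM P1 PT] := set_valP P.
have PJ g x : cone P x -> cone P (g^-1 * x * g).
  by move=> Px; rewrite -(fixP g^-1) cone_LO_act; exists x => //; rewrite invgK.
exists (fun x y => cone P (x^-1 * y)); split; [split| |].
- by move=> x; rewrite mulVg.
- move=> x y z xy yz.
  by have := PM _ _ xy yz; rewrite mulgA mulgK.
- move=> x y xy; have [|h|h] := PT (x^-1 * y); [|by left|].
    by move=> h; apply: xy; rewrite -(mulVKg x y) h mulg1.
  by right; move: h; rewrite invgM invgK.
- by move=> f x y; rewrite invgM !mulgA mulgVK.
- by move=> f x y /(PJ f); rewrite invgM !mulgA.
Qed.

Theorem theorem1p2 (R : realType) (G : groupType) :
  countable [set: G] ->
  left_orderable G ->
  no_nontrivial_finite_quotient G ->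
  ~ bi_orderable G ->
  ~ smooth R (@borel_sets (LO G)) (@E_lo G).
Proof.
move=> cG /left_orderable_LO LO0 noquo nbi [Y [S [f [SY fS fE]]]].
apply: (@infinite_orbits_not_smooth R G (LO G) (@LO_act G)) => //.
- exact: LO_hausdorff.
- exact: LO_compact.
- exact: LO_act_group_action.
- exact: LO_act_continuous.
- move=> P finP; apply: nbi; apply: (@fixed_cone_bi_orderable _ P).
  exact: (finite_orbit_fixed noquo (LO_act_group_action G) finP).
- by exists Y, S, f; split=> // P Q; rewrite -E_loE.
Qed.
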